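(* Let $\varepsilon>0$ and $C_0>0$. There exist constants $c_1,c_2>0$ such that for all sufficiently large $n$ and every integer $k$ with $1\le k\le C_0\,n^{1/2-\varepsilon}$, there exist $m$ and a sequence $S\in[n]^m$ with $\mathsf{WS}(S)\le c_1\, m\log k$ and $\mathsf{F}^{k}(S)\ge c_2\, m\log(n/k)$.
   Context: $\log(x)=\log_2(\max\{2,x\})$. Working set bound: $\mathsf{WS}(X)=\sum_{t=1}^m\log\rho_t(x_t)$, where $\rho_t(a)$ is the number of distinct keys accessed strictly between the last time $s<t$ with $x_s=a$ and time $t$ (all keys considered accessed at time $0$). $k$-finger cost: for a static BST $T$ on $[n]$, $d_T(a,b)$ is the number of edges between $a$ and $b$ in $T$. A $k$-finger strategy is an initial vector $\vec\ell\in[n]^k$ and $\vec f\in[k]^m$, finger $f_t$ serving $x_t$, with cost $\sum_{t=1}^m(1+d_T(x_t,p_t))$ where $p_t$ is the position of finger $f_t$ before time $t$ (its last served key, or $\ell_{f_t}$). $\mathsf{F}^k_T(X)$ is the minimum such cost and $\mathsf{F}^k(X)=\min_T\mathsf{F}^k_T(X)$ over BSTs $T$ on $[n]$. *)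

(* Defs.v *)
From Stdlib Require Import Reals Lra Lia Arith List.
Import ListNotations.
Open Scope R_scope.

Definition lg (x : R) : R := ln (Rmax 2 x) / ln 2.

Fixpoint take_until (a : nat) (s : list nat) : list nat :=
  match s with
  | [] => []
  | y :: s' => if Nat.eqb y a then [] else y :: take_until a s'
  end.

(* rho_t(a), where [prev] = x_1 ... x_{t-1}: number of distinct keys accessed
   strictly after the last access to a before time t (or after time 0 if a
   was never accessed, since all keys are considered accessed at time 0). *)
Definition rho (prev : list nat) (a : nat) : nat :=
  length (nodup Nat.eq_dec (take_until a (rev prev))).

Fixpoint WS_aux (prev : list nat) (X : list nat) : R :=
  match X with
  | [] => 0
  | x :: X' => lg (INR (rho prev x)) + WS_aux (prev ++ [x]) X'
  end.

Definition WS (X : list nat) : R := WS_aux [] X.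

Inductive tree : Type :=
| Leaf : tree
| Node : tree -> nat -> tree -> tree.

Fixpoint inorder (T : tree) : list nat :=
  match T with
  | Leaf => []
  | Node l x r => inorder l ++ x :: inorder r
  end.

Definition is_bst_on (n : nat) (T : tree) : Prop := inorder T = seq 1 n.

Fixpoint inT (a : nat) (T : tree) : bool :=
  match T with
  | Leaf => false
  | Node l x r => Nat.eqb a x || inT a l || inT a r
  end.

Fixpoint root_path (T : tree) (a : nat) : list nat :=
  match T with
  | Leaf => []
  | Node l x r =>
      if Nat.eqb a x then [x]
      else if inT a l then x :: root_path l a
      else if inT a r then x :: root_path r a
      else []
  end.

Fixpoint common_prefix_len (p q : list nat) : nat :=
  match p, q with
  | x :: p', y :: q' => if Nat.eqb x y then S (common_prefix_len p' q') else 0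
  | _, _ => 0
  end.

Definition dist (T : tree) (a b : nat) : nat :=
  let pa := root_path T a in
  let pb := root_path T b in
  (length pa + length pb - 2 * common_prefix_len pa pb)%nat.

Definition upd (pos : nat -> nat) (i v : nat) : nat -> nat :=
  fun j => if Nat.eqb j i then v else pos j.

Fixpoint finger_cost (T : tree) (pos : nat -> nat) (X f : list nat) : nat :=
  match X, f with
  | x :: X', i :: f' => (1 + dist T x (pos i) + finger_cost T (upd pos i x) X' f')%nat
  | _, _ => 0%nat
  end.

Definition valid_strategy (n k : nat) (X : list nat) (l : nat -> nat) (f : list nat) : Prop :=
  (forall i, (i < k)%nat -> (1 <= l i <= n)%nat) /\
  length f = length X /\ Forall (fun i => (i < k)%nat) f.

(* F^k(X) >= c, i.e. min over BSTs T on [n] and k-finger strategies of the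
   cost is at least c (the minimum of a finite nonempty set is >= c iff every
   element is). *)
Definition Fk_ge (k n : nat) (X : list nat) (c : R) : Prop :=
  forall T l f, is_bst_on n T -> valid_strategy n k X l f ->
    c <= INR (finger_cost T l X f).

(* Main.v *)
(** The access sequence runs over all words [A] of length [2k] over [[1..n]] and
    repeats each of them [n] times. After its first pass over [A], every access
    has working-set number at most [2k]; the first pass costs at most [lg n <= n]
    per access, which the [n] repetitions amortise.

    For the lower bound, consider one pass over [A]. At most [k] of its [2k]
    accesses use a finger for the first time in that pass; every other one moves
    a finger between two keys of [A], which costs more than [D] unless these
    keys are at distance at most [D] in the tree. Balls of radius [D] in a binary
    tree have at most [2^(D+2)] keys, so on average a word contains at most
    [2^(D+2) (2k)^2 / n] close pairs, which is at most [k/2] for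
    [D = log2 (n/(32k))]. *)

Require Import Defs.
From Stdlib Require Import Reals List.
From Stdlib Require Import Lra Lia Arith.
Import ListNotations.
(* [Reals] shadows [dist]. *)
Import Defs.
Open Scope R_scope.

(** * Sums and filters over lists *)

Local Open Scope nat_scope.

Lemma length_filter_impl {A} (f g : A -> bool) (l : list A) :
  (forall x, In x l -> f x = true -> g x = true) ->
  length (filter f l) <= length (filter g l).
Proof.
  induction l as [|x l IH]; intros H; simpl; [lia|].
  assert (length (filter f l) <= length (filter g l))
    by (apply IH; intros; apply H; simpl; auto).
  destruct (f x) eqn:E; [rewrite (H x) by (simpl; auto); simpl; lia|].
  destruct (g x); simpl; lia.
Qed.

Lemma list_sum_flat_map {A B} (f : B -> nat) (g : A -> list B) (l : list A) :
  list_sum (map f (flat_map g l)) =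
  list_sum (map (fun x => list_sum (map f (g x))) l).
Proof.
  induction l as [|x l IH]; simpl; [reflexivity|].
  now rewrite map_app, list_sum_app, IH.
Qed.

Lemma list_sum_map_add {A} (f g : A -> nat) (l : list A) :
  list_sum (map (fun x => f x + g x) l) = list_sum (map f l) + list_sum (map g l).
Proof. induction l; simpl; lia. Qed.

Lemma list_sum_map_mul {A} c (f : A -> nat) (l : list A) :
  list_sum (map (fun x => c * f x) l) = c * list_sum (map f l).
Proof. induction l; simpl; lia. Qed.

Lemma list_sum_map_const {A} c (l : list A) :
  list_sum (map (fun _ => c) l) = length l * c.
Proof. induction l; simpl; lia. Qed.

Lemma list_sum_repeat c m : list_sum (repeat c m) = m * c.
Proof. induction m; simpl; lia. Qed.

Lemma list_sum_map_le {A} (f : A -> nat) c (l : list A) :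
  (forall x, In x l -> f x <= c) -> list_sum (map f l) <= length l * c.
Proof.
  induction l as [|x l IH]; intros H; simpl; [lia|].
  assert (f x <= c) by (apply H; simpl; auto).
  assert (list_sum (map f l) <= length l * c)
    by (apply IH; intros; apply H; simpl; auto).
  lia.
Qed.

(** Double counting of the pairs related by [r]. It transfers a bound on the ball around each fixed
    [y] to a sum in which [x] runs over the alphabet. *)
Lemma list_sum_filter_exchange (r : nat -> nat -> bool) (l P : list nat) :
  list_sum (map (fun x => length (filter (r x) P)) l) =
  list_sum (map (fun y => length (filter (fun x => r x y) l)) P).
Proof.
  induction l as [|x l IH]; simpl.
  - now rewrite list_sum_map_const, Nat.mul_0_r.
  - rewrite IH. clear IH.
    induction P as [|y P IHP]; simpl; [reflexivity|].
    destruct (r x y); simpl; lia.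
Qed.

(** * Balls in a binary search tree *)

Lemma inT_In a T : inT a T = true <-> In a (inorder T).
Proof.
  induction T as [|l IHl v r IHr]; simpl; [easy|].
  rewrite in_app_iff, !Bool.orb_true_iff, Nat.eqb_eq, IHl, IHr. simpl.
  intuition.
Qed.

Lemma root_path_In T a y : In y (root_path T a) -> In y (inorder T).
Proof.
  induction T as [|l IHl v r IHr]; simpl; [easy|].
  rewrite in_app_iff. simpl.
  destruct (Nat.eqb a v); [simpl; tauto|].
  destruct (inT a l); [simpl; tauto|].
  destruct (inT a r); simpl; tauto.
Qed.

Lemma root_path_root l v r : root_path (Node l v r) v = [v].
Proof. simpl. now rewrite Nat.eqb_refl. Qed.

Lemma root_path_left l v r a :
  NoDup (inorder (Node l v r)) -> In a (inorder l) ->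
  root_path (Node l v r) a = v :: root_path l a.
Proof.
  intros ND Ha. simpl in *.
  destruct (Nat.eqb_spec a v) as [->|_].
  - apply NoDup_remove_2 in ND. rewrite in_app_iff in ND. tauto.
  - now rewrite (proj2 (inT_In a l)).
Qed.

Lemma inorder_disjoint l v r a :
  NoDup (inorder (Node l v r)) -> In a (inorder l) -> In a (inorder r) -> False.
Proof.
  simpl. intros ND Hl Hr. apply NoDup_remove_1 in ND.
  apply in_split in Hl as [u [w E]]. rewrite E, <- app_assoc in ND.
  simpl in ND. apply NoDup_remove_2 in ND. rewrite !in_app_iff in ND. tauto.
Qed.

Lemma root_path_right l v r a :
  NoDup (inorder (Node l v r)) -> In a (inorder r) ->
  root_path (Node l v r) a = v :: root_path r a.
Proof.
  intros ND Ha. pose proof (inorder_disjoint l v r a ND) as Hd. simpl in *.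
  destruct (Nat.eqb_spec a v) as [->|_].
  - apply NoDup_remove_2 in ND. rewrite in_app_iff in ND. tauto.
  - destruct (inT a l) eqn:E; [apply inT_In in E; tauto|].
    now rewrite (proj2 (inT_In a r)).
Qed.

Lemma length_root_path_pos T a : In a (inorder T) -> 1 <= length (root_path T a).
Proof.
  destruct T as [|l v r]; simpl; [easy|].
  intros H. apply in_app_iff in H. simpl in H.
  destruct (Nat.eqb_spec a v); [simpl; lia|].
  destruct (inT a l) eqn:El; [simpl; lia|].
  destruct (inT a r) eqn:Er; [simpl; lia|].
  rewrite <- !inT_In, El, Er in H. intuition congruence.
Qed.

Lemma common_prefix_len_disjoint p q :
  (forall a, In a p -> In a q -> False) -> common_prefix_len p q = 0.
Proof.
  destruct p as [|x p], q as [|y q]; simpl; intros H; try reflexivity.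
  destruct (Nat.eqb_spec x y) as [->|]; [|reflexivity].
  exfalso. apply (H y); auto.
Qed.

Lemma NoDup_left l v r : NoDup (inorder (Node l v r)) -> NoDup (inorder l).
Proof. simpl. apply NoDup_app_remove_r. Qed.

Lemma NoDup_right l v r : NoDup (inorder (Node l v r)) -> NoDup (inorder r).
Proof. simpl. intros H. apply NoDup_remove_1 in H. now apply NoDup_app_remove_l in H. Qed.

(** [root_path] counts nodes, so [e] is a number of levels. With the [+ 1], the bound on the two
    subtrees together with their root exactly doubles from [e] to [S e], and the induction
    closes. *)
Lemma depth_ball T e :
  NoDup (inorder T) ->
  length (filter (fun x => length (root_path T x) <=? e) (inorder T)) + 1 <= 2 ^ e.
Proof.
  revert e. induction T as [|l IHl v r IHr]; intros e ND.
  - simpl. pose proof (Nat.pow_nonzero 2 e). lia.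
  - specialize (fun e => IHl e (NoDup_left _ _ _ ND)).
    specialize (fun e => IHr e (NoDup_right _ _ _ ND)).
    change (inorder (Node l v r)) with (inorder l ++ v :: inorder r) at 1.
    rewrite filter_app, length_app.
    cbn [filter]. rewrite root_path_root.
    destruct e as [|e].
    + assert (Hl : length (filter (fun x => length (root_path (Node l v r) x) <=? 0) (inorder l))
                   <= length (filter (fun _ => false) (inorder l))).
      { apply length_filter_impl. intros x Hx E.
        rewrite root_path_left in E; auto. }
      assert (Hr : length (filter (fun x => length (root_path (Node l v r) x) <=? 0) (inorder r))
                   <= length (filter (fun _ => false) (inorder r))).
      { apply length_filter_impl. intros x Hx E.
        rewrite root_path_right in E; auto. }
      rewrite filter_false in Hl, Hr. simpl in *. lia.
    + assert (Hl : length (filter (fun x => length (root_path (Node l v r) x) <=? S e) (inorder l))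
                   <= length (filter (fun x => length (root_path l x) <=? e) (inorder l))).
      { apply length_filter_impl. intros x Hx E.
        rewrite root_path_left in E; auto. }
      assert (Hr : length (filter (fun x => length (root_path (Node l v r) x) <=? S e) (inorder r))
                   <= length (filter (fun x => length (root_path r x) <=? e) (inorder r))).
      { apply length_filter_impl. intros x Hx E.
        rewrite root_path_right in E; auto. }
      specialize (IHl e). specialize (IHr e).
      rewrite Nat.pow_succ_r'. cbn [length Nat.leb]. lia.
Qed.

(** Meant for the sibling subtree of the one containing [b], where [e] is the distance from [b] up
    to the common parent. The extra 1 on the left reserves room for that parent, which lies in the
    ball exactly when [e <= D]. *)
Lemma far_subtree_ball T D e :
  NoDup (inorder T) ->
  length (filter (fun x => length (root_path T x) + e <=? D) (inorder T))
    + (if e <=? D then 1 else 0) <= if e <=? D then 2 ^ (D - e) else 0.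
Proof.
  intros ND. destruct (Nat.leb_spec e D).
  - pose proof (depth_ball T (D - e) ND).
    enough (length (filter (fun x => length (root_path T x) + e <=? D) (inorder T))
      <= length (filter (fun x => length (root_path T x) <=? D - e) (inorder T))) by lia.
    apply length_filter_impl. intros x _. rewrite !Nat.leb_le. lia.
  - enough (length (filter (fun x => length (root_path T x) + e <=? D) (inorder T))
      <= length (filter (fun _ => false) (inorder T))) as E
      by (rewrite filter_false in E; simpl in E; lia).
    apply length_filter_impl. intros x _. rewrite Nat.leb_le. lia.
Qed.

(** Going up one level halves the slack. If [L <= D], the freed half [2 ^ (D + 1 - L)] pays for the
    at most [2 ^ (D - L)] keys that come into reach. If [L > D], none do, and under truncated
    subtraction the slack still does not grow. *)
Lemma ball_step D L a b :
  1 <= L -> a + 2 ^ (D + 2 - L) <= 2 ^ (D + 2) ->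
  b <= (if L <=? D then 2 ^ (D - L) else 0) ->
  a + b + 2 ^ (D + 2 - S L) <= 2 ^ (D + 2).
Proof.
  intros HL Ha Hb. destruct (Nat.leb_spec L D).
  - replace (D + 2 - L) with (S (S (D - L))) in Ha by lia.
    replace (D + 2 - S L) with (S (D - L)) by lia.
    rewrite !Nat.pow_succ_r' in *. lia.
  - assert (2 ^ (D + 2 - S L) <= 2 ^ (D + 2 - L))
      by (apply Nat.pow_le_mono_r; lia).
    lia.
Qed.

(* The extra term on the left leaves room for the keys reached through the
   ancestors of [T] in a larger tree; it halves at each level. *)
Lemma ball_slack T D b :
  NoDup (inorder T) -> In b (inorder T) ->
  length (filter (fun x => dist T x b <=? D) (inorder T))
    + 2 ^ (D + 2 - length (root_path T b)) <= 2 ^ (D + 2).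
Proof.
  induction T as [|l IHl v r IHr]; intros ND Hb; [easy|].
  assert (Hcases : b = v \/ In b (inorder l) \/ In b (inorder r)).
  { simpl in Hb. apply in_app_iff in Hb. simpl in Hb. intuition. }
  pose proof (NoDup_left _ _ _ ND) as NDl.
  pose proof (NoDup_right _ _ _ ND) as NDr.
  destruct Hcases as [->|[Hl|Hr]].
  (* The ball around the root lies in the top [S D] levels, so it has fewer than [2 ^ (D + 1)] keys;
     the slack is the other [2 ^ (D + 1)]. *)
  - pose proof (depth_ball (Node l v r) (S D) ND) as Hd.
    assert (length (filter (fun x => dist (Node l v r) x v <=? D) (inorder (Node l v r)))
      <= length (filter (fun x => length (root_path (Node l v r) x) <=? S D)
                   (inorder (Node l v r)))).
    { apply length_filter_impl. intros x Hx. unfold dist.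
      rewrite root_path_root, !Nat.leb_le. cbn [length].
      assert (common_prefix_len (root_path (Node l v r) x) [v] <= 1).
      { destruct (root_path (Node l v r) x) as [|y p]; simpl; [lia|].
        destruct (y =? v); [|lia]. destruct p; simpl; lia. }
      lia. }
    rewrite root_path_root. cbn [length].
    replace (D + 2 - 1) with (S D) by lia.
    replace (D + 2) with (S (S D)) by lia.
    rewrite (Nat.pow_succ_r' 2 (S D)). lia.
  - specialize (IHl NDl Hl).
    pose proof (length_root_path_pos l b Hl) as HL.
    rewrite (root_path_left l v r b ND Hl). cbn [length].
    change (inorder (Node l v r)) with (inorder l ++ v :: inorder r) at 1.
    rewrite filter_app, length_app.
    set (L := length (root_path l b)) in *.
    pose proof (far_subtree_ball r D L NDr) as Hfar.
    (* Both root paths and their common prefix gain the key [v], so distances inside the subtree do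
       not change. *)
    assert (El : length (filter (fun x => dist (Node l v r) x b <=? D) (inorder l))
                 <= length (filter (fun x => dist l x b <=? D) (inorder l))).
    { apply length_filter_impl. intros x Hx. unfold dist.
      rewrite !root_path_left by auto. rewrite !Nat.leb_le. cbn [length common_prefix_len].
      rewrite Nat.eqb_refl. lia. }
    (* The two subtrees have no key in common, so the root paths share only [v] and the distance is
       the sum of the two depths below [v]. *)
    assert (Er : length (filter (fun x => dist (Node l v r) x b <=? D) (inorder r))
                 <= length (filter (fun x => length (root_path r x) + L <=? D) (inorder r))).
    { apply length_filter_impl. intros x Hx. unfold dist.
      rewrite (root_path_left l v r b), (root_path_right l v r x) by auto. rewrite !Nat.leb_le. cbn [length common_prefix_len].
      rewrite Nat.eqb_refl, common_prefix_len_disjoint; [unfold L; lia|].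
      intros y Hy1 Hy2. apply root_path_In in Hy1, Hy2.
      eapply inorder_disjoint; eauto. }
    assert (Ev : length (filter (fun x => dist (Node l v r) x b <=? D) (v :: inorder r))
                 <= (if L <=? D then 2 ^ (D - L) else 0)).
    { cbn [filter].
      assert (Ed : dist (Node l v r) v b = L).
      { unfold dist. rewrite root_path_root, root_path_left by auto. cbn [length common_prefix_len].
        rewrite Nat.eqb_refl. unfold L. lia. }
      rewrite Ed. destruct (L <=? D); cbn [length]; lia. }
    pose proof (ball_step D L _ _ HL IHl Ev). lia.
  - specialize (IHr NDr Hr).
    pose proof (length_root_path_pos r b Hr) as HL.
    rewrite (root_path_right l v r b ND Hr). cbn [length].
    change (inorder (Node l v r)) with (inorder l ++ v :: inorder r) at 1.
    rewrite filter_app, length_app.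
    set (L := length (root_path r b)) in *.
    pose proof (far_subtree_ball l D L NDl) as Hfar.
    assert (Er : length (filter (fun x => dist (Node l v r) x b <=? D) (inorder r))
                 <= length (filter (fun x => dist r x b <=? D) (inorder r))).
    { apply length_filter_impl. intros x Hx. unfold dist.
      rewrite !root_path_right by auto. rewrite !Nat.leb_le. cbn [length common_prefix_len].
      rewrite Nat.eqb_refl. lia. }
    assert (El : length (filter (fun x => dist (Node l v r) x b <=? D) (inorder l))
                 <= length (filter (fun x => length (root_path l x) + L <=? D) (inorder l))).
    { apply length_filter_impl. intros x Hx. unfold dist.
      rewrite (root_path_left l v r x), (root_path_right l v r b) by auto. rewrite !Nat.leb_le. cbn [length common_prefix_len].
      rewrite Nat.eqb_refl, common_prefix_len_disjoint; [unfold L; lia|].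
      intros y Hy1 Hy2. apply root_path_In in Hy1, Hy2.
      eapply inorder_disjoint; eauto. }
    cbn [filter].
    assert (Ed : dist (Node l v r) v b = L).
    { unfold dist. rewrite root_path_root, root_path_right by auto. cbn [length common_prefix_len].
      rewrite Nat.eqb_refl. unfold L. lia. }
    rewrite Ed.
    pose proof (ball_step D L _ _ HL IHr (Nat.le_refl _)).
    destruct (L <=? D); cbn [length]; lia.
Qed.

Lemma ball_bound T D b :
  NoDup (inorder T) -> In b (inorder T) ->
  length (filter (fun x => dist T x b <=? D) (inorder T)) <= 2 ^ (D + 2).
Proof. intros ND Hb. pose proof (ball_slack T D b ND Hb). lia. Qed.

(** * Close pairs in words *)

Fixpoint words (al : list nat) (K : nat) : list (list nat) :=
  match K with
  | 0 => [[]]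
  | S K' => flat_map (fun x => map (cons x) (words al K')) al
  end.

Lemma length_words al K : length (words al K) = length al ^ K.
Proof.
  induction K as [|K IH]; simpl; [reflexivity|].
  rewrite (flat_map_constant_length (c := length al ^ K)); [reflexivity|].
  intros x _. now rewrite length_map.
Qed.

Lemma words_In al K A :
  In A (words al K) -> length A = K /\ forall x, In x A -> In x al.
Proof.
  revert A. induction K as [|K IH]; simpl; intros A H.
  - destruct H as [<-|[]]. simpl. tauto.
  - apply in_flat_map in H as [x [Hx H]]. apply in_map_iff in H as [A' [<- H]].
    destruct (IH _ H) as [<- HA]. simpl. split; [reflexivity|].
    intros y [<-|Hy]; auto.
Qed.

(** Pairs are pairs of positions, so repeated letters count with multiplicity. [P] accumulates the
    earlier letters, and [r] takes the later letter first. *)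
Fixpoint close_pairs (r : nat -> nat -> bool) (P A : list nat) : nat :=
  match A with
  | [] => 0
  | x :: A' => length (filter (r x) P) + close_pairs r (x :: P) A'
  end.

(** An expectation with denominators cleared: in a uniformly random word, a letter is related to a
    given earlier one with probability at most [B / length al], and there are at most
    [K * (length P + K)] pairs of positions. *)
Lemma close_pairs_words (r : nat -> nat -> bool) al B K P :
  (forall y, In y al -> length (filter (fun x => r x y) al) <= B) ->
  (forall y, In y P -> In y al) ->
  length al * list_sum (map (close_pairs r P) (words al K))
    <= B * length al ^ K * (K * (length P + K)).
Proof.
  intros HB. revert P. induction K as [|K IH]; intros P HP; [simpl; lia|].
  (* Split off the first letter: its pairs with [P] recur for each of the [length al ^ K] tails. *)
  assert (E : list_sum (map (close_pairs r P) (words al (S K))) =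
    length al ^ K * list_sum (map (fun x => length (filter (r x) P)) al) +
    list_sum (map (fun x => list_sum (map (close_pairs r (x :: P)) (words al K))) al)).
  { cbn [words]. rewrite list_sum_flat_map, <- list_sum_map_mul, <- list_sum_map_add.
    f_equal. apply map_ext. intros x. rewrite map_map. simpl.
    now rewrite list_sum_map_add, list_sum_map_const, length_words. }
  rewrite E, list_sum_filter_exchange. clear E.
  assert (H1 : list_sum (map (fun y => length (filter (fun x => r x y) al)) P)
               <= length P * B) by (apply list_sum_map_le; auto).
  assert (H2 : list_sum (map (fun x => length al *
      list_sum (map (close_pairs r (x :: P)) (words al K))) al)
      <= length al * (B * length al ^ K * (K * (S (length P) + K)))).
  { apply list_sum_map_le. intros x Hx. apply (IH (x :: P)).
    intros y [<-|Hy]; auto. }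
  rewrite list_sum_map_mul in H2.
  rewrite Nat.pow_succ_r'.
  rewrite Nat.mul_add_distr_l.
  eapply Nat.le_trans; [apply Nat.add_le_mono; [|exact H2]|].
  - apply Nat.mul_le_mono_l, Nat.mul_le_mono_l, H1.
  - nia.
Qed.

(** * Lower bound on the finger cost *)

(* [U] lists the fingers already used in the current pass and [P] the keys
   served in it. *)
Lemma finger_cost_word_aux T k D A f pos U P :
  length f = length A -> Forall (fun i => i < k) f ->
  NoDup U -> (forall i, In i U -> i < k) -> (forall i, In i U -> In (pos i) P) ->
  S D * (length A + length U) <=
  finger_cost T pos A f +
    S D * (k + close_pairs (fun x y => dist T x y <=? D) P A).
Proof.
  revert f pos U P.
  induction A as [|x A IH]; intros [|i f] pos U P Hlen Hf ND HU HP; try easy.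
  - simpl finger_cost. simpl close_pairs. simpl length.
    assert (length U <= k).
    { rewrite <- (length_seq k 0). apply NoDup_incl_length; [assumption|].
      intros j Hj. apply in_seq. specialize (HU j Hj). lia. }
    nia.
  - inversion Hf as [|i' f' Hi Hf']; subst. injection Hlen as Hlen.
    cbn [finger_cost close_pairs length].
    destruct (in_dec Nat.eq_dec i U) as [Hin|Hout].
    + specialize (IH f (upd pos i x) U (x :: P) Hlen Hf' ND HU).
      (* Finger [i] stands on a key of [P]: either its move pays [S D], or that key forms a close
         pair with [x]. *)
      assert (Hc : S D <= 1 + dist T x (pos i) \/
                   1 <= length (filter (fun y => dist T x y <=? D) P)).
      { destruct (Nat.leb_spec (dist T x (pos i)) D) as [Hle|]; [right|left; lia].
        assert (Hy : In (pos i) (filter (fun y => dist T x y <=? D) P)).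
        { apply filter_In. split; [auto|]. now apply Nat.leb_le. }
        destruct (filter _ P); [easy|]. simpl. lia. }
      assert (Hinv : forall j, In j U -> In (upd pos i x j) (x :: P)).
      { intros j Hj. unfold upd. destruct (Nat.eqb j i); simpl; auto. }
      specialize (IH Hinv). nia.
    (* A first use is free: [A] loses a letter while [U] gains a finger, so the left-hand side stays
       the same. *)
    + specialize (IH f (upd pos i x) (i :: U) (x :: P) Hlen Hf').
      assert (S D * (length A + length (i :: U)) <=
        finger_cost T (upd pos i x) A f +
        S D * (k + close_pairs (fun x y => dist T x y <=? D) (x :: P) A)).
      { apply IH.
        - now constructor.
        - intros j [<-|Hj]; auto.
        - intros j [<-|Hj]; unfold upd; [rewrite Nat.eqb_refl; simpl; auto|].
          destruct (Nat.eqb j i); simpl; auto. }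
      cbn [length] in *. nia.
Qed.

Lemma finger_cost_word T k D A f pos :
  length f = length A -> Forall (fun i => i < k) f ->
  S D * length A <=
  finger_cost T pos A f +
    S D * (k + close_pairs (fun x y => dist T x y <=? D) [] A).
Proof.
  intros Hlen Hf.
  pose proof (finger_cost_word_aux T k D A f pos [] [] Hlen Hf (NoDup_nil _)) as H.
  simpl length in H. rewrite Nat.add_0_r in H. apply H; easy.
Qed.

Lemma finger_cost_app T pos X Y f g :
  length f = length X ->
  exists pos', finger_cost T pos (X ++ Y) (f ++ g) =
    finger_cost T pos X f + finger_cost T pos' Y g.
Proof.
  revert pos f. induction X as [|x X IH]; intros pos [|i f] Hlen; try easy.
  - now exists pos.
  - injection Hlen as Hlen. destruct (IH (upd pos i x) f Hlen) as [pos' E].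
    exists pos'. simpl. rewrite E. lia.
Qed.

(** The bound for one word holds from any finger positions, so it adds up over consecutive passes,
    with [k] free first uses granted anew in each. *)
Lemma finger_cost_concat T k D (Bs : list (list nat)) f pos :
  length f = length (concat Bs) -> Forall (fun i => i < k) f ->
  S D * length (concat Bs) <=
  finger_cost T pos (concat Bs) f +
    S D * list_sum (map (fun A => k + close_pairs (fun x y => dist T x y <=? D) [] A) Bs).
Proof.
  revert f pos. induction Bs as [|A Bs IH]; intros f pos Hlen Hf; [simpl; lia|].
  cbn [concat map list_sum fold_right] in *. rewrite length_app in *.
  rewrite <- (firstn_skipn (length A) f) in Hf |- *.
  apply Forall_app in Hf as [Hf1 Hf2].
  assert (L1 : length (firstn (length A) f) = length A)
    by (rewrite length_firstn; lia).
  assert (L2 : length (skipn (length A) f) = length (concat Bs))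
    by (rewrite length_skipn; lia).
  destruct (finger_cost_app T pos A (concat Bs) _ (skipn (length A) f) L1) as [pos' ->].
  pose proof (finger_cost_word T k D A _ pos L1 Hf1).
  specialize (IH _ pos' L2 Hf2). unfold list_sum in IH. lia.
Qed.

Lemma finger_cost_ge_length T pos X f :
  length f = length X -> length X <= finger_cost T pos X f.
Proof.
  revert pos f. induction X as [|x X IH]; intros pos [|i f] Hlen; try easy.
  injection Hlen as Hlen. specialize (IH (upd pos i x) f Hlen). simpl. lia.
Qed.

(** One sequence has to be bad for every tree. Since it contains all words equally often, an average
    over words applies whichever tree is chosen. *)
Definition all_words_repeated (n K R : nat) : list (list nat) :=
  flat_map (fun A => repeat A R) (words (seq 1 n) K).

Lemma length_concat_const {A} (Bs : list (list A)) c :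
  (forall B, In B Bs -> length B = c) -> length (concat Bs) = length Bs * c.
Proof.
  induction Bs as [|B Bs IH]; intros H; simpl; [reflexivity|].
  rewrite length_app, IH, (H B); simpl; auto. intros; apply H; simpl; auto.
Qed.

Lemma all_words_repeated_In n K R A :
  In A (all_words_repeated n K R) ->
  length A = K /\ forall x, In x A -> 1 <= x <= n.
Proof.
  intros H. apply in_flat_map in H as [B [HB H]]. apply repeat_spec in H as ->.
  apply words_In in HB as [HL HB]. split; [exact HL|].
  intros x Hx. apply HB, in_seq in Hx. lia.
Qed.

Lemma length_all_words_repeated n K R :
  length (all_words_repeated n K R) = n ^ K * R.
Proof.
  unfold all_words_repeated.
  rewrite (flat_map_constant_length (c := R)).
  - now rewrite length_words, length_seq.
  - intros; apply repeat_length.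
Qed.

Lemma length_concat_all_words_repeated n K R :
  length (concat (all_words_repeated n K R)) = n ^ K * R * K.
Proof.
  rewrite (length_concat_const _ K), length_all_words_repeated; [reflexivity|].
  intros B HB. now apply all_words_repeated_In in HB.
Qed.

(** Of the [2k] accesses in a pass, [k] are lost to first uses and on average at most [k/2] to close
    pairs. At least a quarter remain, each costing [S D]; hence the factor 4. *)
Lemma finger_cost_all_words n k R D T pos f :
  1 <= n -> is_bst_on n T -> 2 ^ D * (32 * k) <= n ->
  length f = length (concat (all_words_repeated n (2 * k) R)) ->
  Forall (fun i => i < k) f ->
  S D * length (concat (all_words_repeated n (2 * k) R)) <=
  4 * finger_cost T pos (concat (all_words_repeated n (2 * k) R)) f.
Proof.
  intros Hn HT HD Hlen Hf.
  pose proof (finger_cost_concat T k D _ f pos Hlen Hf) as H.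
  set (r := fun x y => dist T x y <=? D) in *.
  rewrite length_concat_all_words_repeated in *.
  rewrite list_sum_map_add, list_sum_map_const, length_all_words_repeated in H.
  assert (E : list_sum (map (close_pairs r []) (all_words_repeated n (2 * k) R)) =
              R * list_sum (map (close_pairs r []) (words (seq 1 n) (2 * k)))).
  { unfold all_words_repeated. rewrite list_sum_flat_map, <- list_sum_map_mul.
    f_equal. apply map_ext. intros A. now rewrite map_repeat, list_sum_repeat. }
  change (fun x => close_pairs r [] x) with (close_pairs r []) in H.
  rewrite E in H. clear E.
  assert (Hcp : length (seq 1 n) * list_sum (map (close_pairs r []) (words (seq 1 n) (2 * k)))
     <= 2 ^ (D + 2) * length (seq 1 n) ^ (2 * k) * (2 * k * (length (@nil nat) + 2 * k))).
  { apply close_pairs_words; [|easy]. intros y Hy. unfold r.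
    rewrite <- HT in Hy |- *. apply ball_bound; [|exact Hy].
    rewrite HT. apply seq_NoDup. }
  rewrite length_seq in Hcp.
  set (s := list_sum (map (close_pairs r []) (words (seq 1 n) (2 * k)))) in *.
  set (N := n ^ (2 * k)) in *.
  (* [2 * n * s <= 2 * (4 * 2 ^ D) * N * (2k)^2 = 2 ^ D * (32k) * (k * N) <= n * (k * N)]; this is
     where 32 comes from. *)
  assert (Hs : 2 * s <= k * N).
  { replace (2 ^ (D + 2)) with (4 * 2 ^ D) in Hcp
      by (rewrite Nat.pow_add_r; simpl (2 ^ 2); lia).
    simpl (length (@nil nat)) in Hcp.
    assert (Hm : 2 ^ D * (32 * k) * (k * N) <= n * (k * N))
      by now apply Nat.mul_le_mono_r.
    apply (Nat.mul_le_mono_pos_l _ _ n); [lia|]. nia. }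
  assert (S D * (R * (2 * s)) <= S D * (R * (k * N)))
    by (apply Nat.mul_le_mono_l, Nat.mul_le_mono_l, Hs).
  nia.
Qed.

(** * Upper bound on the working-set cost *)

Lemma take_until_incl a s x : In x (take_until a s) -> In x s.
Proof.
  induction s as [|y s IH]; simpl; [easy|].
  destruct (Nat.eqb y a); simpl; [easy|]. intuition.
Qed.

Lemma length_take_until a u v : length (take_until a (u ++ a :: v)) <= length u.
Proof.
  induction u as [|y u IH]; simpl.
  - rewrite Nat.eqb_refl. simpl. lia.
  - destruct (Nat.eqb y a); simpl; lia.
Qed.

Lemma rho_le_alphabet n prev a :
  Forall (fun x => 1 <= x <= n) prev -> rho prev a <= n.
Proof.
  intros H. unfold rho. rewrite <- (length_seq n 1).
  apply NoDup_incl_length; [apply NoDup_nodup|].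
  intros x Hx. apply nodup_In, take_until_incl, in_rev in Hx.
  rewrite Forall_forall in H. specialize (H x Hx). apply in_seq. lia.
Qed.

(** Scanning backwards stops at the displayed [a] at the latest, so only letters of [s] can be
    collected. *)
Lemma rho_le_recent prev a s : rho (prev ++ a :: s) a <= length s.
Proof.
  unfold rho. rewrite rev_app_distr. simpl. rewrite <- app_assoc. simpl.
  rewrite <- (length_rev s).
  transitivity (length (take_until a (rev s ++ a :: rev prev)));
    [|apply length_take_until].
  apply NoDup_incl_length; [apply NoDup_nodup|].
  intros x Hx. now apply nodup_In in Hx.
Qed.

Local Open Scope R_scope.

Lemma ln2_pos : 0 < ln 2.
Proof. rewrite <- ln_1. apply ln_increasing; lra. Qed.

Lemma lg_le x y : x <= y -> lg x <= lg y.
Proof.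
  intros H. unfold lg. apply Rmult_le_compat_r.
  - left. apply Rinv_0_lt_compat, ln2_pos.
  - assert (Rmax 2 x <= Rmax 2 y) by (apply Rle_max_compat_l, H).
    pose proof (Rmax_l 2 x).
    destruct (Req_dec (Rmax 2 x) (Rmax 2 y)) as [->|]; [lra|].
    left. apply ln_increasing; lra.
Qed.

Lemma lg_le_of_le_pow x j : x <= 2 ^ j -> (1 <= j)%nat -> lg x <= INR j.
Proof.
  intros H Hj.
  assert (H2 : 2 <= 2 ^ j) by (rewrite <- (pow_1 2) at 1; apply Rle_pow; (lra || lia)).
  eapply Rle_trans; [apply lg_le, H|].
  unfold lg. rewrite Rmax_right by exact H2. rewrite ln_pow by lra.
  pose proof ln2_pos. right. field. lra.
Qed.

Lemma lg_ge_1 x : 1 <= lg x.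
Proof.
  pose proof ln2_pos.
  assert (E : lg 2 = 1) by (unfold lg; rewrite Rmax_left by lra; field; lra).
  assert (E' : lg (Rmin 2 x) = 1).
  { unfold lg. rewrite Rmax_left by apply Rmin_l. field. lra. }
  rewrite <- E'. apply lg_le, Rmin_r.
Qed.

Lemma lg_double x : lg (2 * x) <= 1 + lg x.
Proof.
  pose proof ln2_pos. pose proof (Rmax_l 2 x).
  assert (E : lg (2 * Rmax 2 x) = 1 + lg x).
  { unfold lg. rewrite (Rmax_right 2 (2 * Rmax 2 x)) by lra.
    rewrite ln_mult by lra. field. lra. }
  rewrite <- E. apply lg_le. pose proof (Rmax_r 2 x). lra.
Qed.

Lemma lg_INR_le n : (1 <= n)%nat -> lg (INR n) <= INR n.
Proof.
  intros Hn. apply lg_le_of_le_pow; [|exact Hn].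
  replace 2 with (INR 2) by reflexivity. rewrite <- pow_INR.
  apply le_INR. pose proof (Nat.pow_gt_lin_r 2 n). lia.
Qed.

Lemma WS_aux_app prev X Y :
  WS_aux prev (X ++ Y) = WS_aux prev X + WS_aux (prev ++ X) Y.
Proof.
  revert prev. induction X as [|x X IH]; intros prev; simpl.
  - rewrite app_nil_r. lra.
  - rewrite IH, <- app_assoc. simpl. lra.
Qed.

Lemma WS_aux_alphabet n prev X :
  Forall (fun x => (1 <= x <= n)%nat) prev ->
  Forall (fun x => (1 <= x <= n)%nat) X ->
  WS_aux prev X <= INR (length X) * lg (INR n).
Proof.
  revert prev. induction X as [|x X IH]; intros prev Hp HX.
  - simpl. lra.
  - cbn [WS_aux length]. rewrite S_INR.
    inversion HX as [|x' X' Hx HX']; subst.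
    assert (WS_aux (prev ++ [x]) X <= INR (length X) * lg (INR n)).
    { apply IH; [|assumption]. apply Forall_app. auto. }
    pose proof (lg_le _ _ (le_INR _ _ (rho_le_alphabet n prev x Hp))). lra.
Qed.

(** The word is [A1 ++ A2], with its second pass already advanced through [A1]. Between the two
    accesses at the same position of the word lie only its other positions. *)
Lemma WS_aux_second_pass_suffix prev A1 A2 :
  WS_aux (prev ++ A1 ++ A2 ++ A1) A2 <=
  INR (length A2) * lg (INR (length (A1 ++ A2))).
Proof.
  revert A1. induction A2 as [|x A2 IH]; intros A1.
  - simpl. lra.
  - cbn [WS_aux length]. rewrite S_INR.
    specialize (IH (A1 ++ [x])).
    rewrite <- !app_assoc in *. simpl in *.
    assert (Hr : (rho (prev ++ A1 ++ x :: A2 ++ A1) x <= length (A1 ++ x :: A2))%nat).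
    { rewrite app_assoc. eapply Nat.le_trans; [apply rho_le_recent|].
      rewrite !length_app. simpl. lia. }
    apply le_INR, lg_le in Hr. lra.
Qed.

Lemma WS_aux_second_pass prev A :
  WS_aux (prev ++ A) A <= INR (length A) * lg (INR (length A)).
Proof.
  pose proof (WS_aux_second_pass_suffix prev [] A) as H.
  simpl in H. rewrite app_nil_r in H. exact H.
Qed.

Lemma WS_aux_repeat prev A R :
  WS_aux (prev ++ A) (concat (repeat A R)) <=
  INR R * INR (length A) * lg (INR (length A)).
Proof.
  revert prev. induction R as [|R IH]; intros prev.
  - simpl. lra.
  - cbn [repeat concat]. rewrite WS_aux_app, S_INR.
    pose proof (WS_aux_second_pass prev A). specialize (IH (prev ++ A)). lra.
Qed.

(** The first pass costs up to [lg n <= R] per access; spread over the [R] passes, this is the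
    summand 1. Later passes cost at most [lg (length A)] per access. *)
Lemma WS_aux_phase n prev A R :
  Forall (fun x => (1 <= x <= n)%nat) prev ->
  Forall (fun x => (1 <= x <= n)%nat) A ->
  (1 <= R)%nat -> lg (INR n) <= INR R ->
  WS_aux prev (concat (repeat A R)) <=
  INR R * INR (length A) * (1 + lg (INR (length A))).
Proof.
  intros Hp HA HR Hlg. destruct R as [|R]; [lia|].
  cbn [repeat concat]. rewrite WS_aux_app.
  pose proof (WS_aux_alphabet n prev A Hp HA).
  pose proof (WS_aux_repeat prev A R).
  rewrite S_INR in *.
  pose proof (pos_INR (length A)) as HL.
  pose proof (lg_ge_1 (INR (length A))).
  assert (INR (length A) * lg (INR n) <= INR (length A) * (INR R + 1))
    by (apply Rmult_le_compat_l; lra).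
  assert (0 <= INR (length A) * lg (INR (length A)))
    by (apply Rmult_le_pos; lra).
  lra.
Qed.

Lemma WS_aux_phases n K R (W : list (list nat)) prev :
  Forall (fun x => (1 <= x <= n)%nat) prev ->
  (forall A, In A W -> length A = K /\ Forall (fun x => (1 <= x <= n)%nat) A) ->
  (1 <= R)%nat -> lg (INR n) <= INR R ->
  WS_aux prev (concat (flat_map (fun A => repeat A R) W)) <=
  INR (length W) * (INR R * INR K * (1 + lg (INR K))).
Proof.
  intros Hp HW HR Hlg. revert prev Hp.
  induction W as [|A W IH]; intros prev Hp.
  - simpl. lra.
  - cbn [flat_map length]. rewrite concat_app, WS_aux_app, S_INR.
    destruct (HW A) as [<- HA]; [simpl; auto|].
    pose proof (WS_aux_phase n prev A R Hp HA HR Hlg).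
    assert (WS_aux (prev ++ concat (repeat A R)) (concat (flat_map (fun A => repeat A R) W))
      <= INR (length W) * (INR R * INR (length A) * (1 + lg (INR (length A))))).
    { apply IH; [intros; apply HW; simpl; auto|].
      apply Forall_app. split; [exact Hp|]. apply Forall_concat.
      apply Forall_forall. intros B HB. apply repeat_spec in HB. now subst. }
    lra.
Qed.

Lemma WS_all_words n k R :
  (1 <= R)%nat -> lg (INR n) <= INR R ->
  WS (concat (all_words_repeated n (2 * k) R)) <=
  3 * INR (length (concat (all_words_repeated n (2 * k) R))) * lg (INR k).
Proof.
  intros HR Hlg.
  assert (H : WS (concat (all_words_repeated n (2 * k) R)) <=
    INR (length (words (seq 1 n) (2 * k))) * (INR R * INR (2 * k) * (1 + lg (INR (2 * k))))).
  { apply (WS_aux_phases n); auto. intros A HA.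
    apply words_In in HA as [HL HA]. split; [exact HL|].
    apply Forall_forall. intros x Hx. apply HA, in_seq in Hx. lia. }
  rewrite length_concat_all_words_repeated.
  rewrite length_words, length_seq in H.
  eapply Rle_trans; [exact H|].
  rewrite !(mult_INR (_ * _)), (mult_INR (_ ^ _)).
  (* Doubling adds at most 1 to [lg], and [lg] is at least 1 by its truncation; this gives the
     constant 3. *)
  assert (1 + lg (INR (2 * k)) <= 3 * lg (INR k)).
  { rewrite mult_INR. change (INR 2) with 2. pose proof (lg_double (INR k)).
    pose proof (lg_ge_1 (INR k)). lra. }
  assert (0 <= INR (n ^ (2 * k)) * (INR R * INR (2 * k)))
    by (repeat apply Rmult_le_pos; apply pos_INR).
  nra.
Qed.

(** * Choice of the radius *)

(** Dividing by 32 costs 5 bits. As the successor of the radius is at least 1, these 5 bits are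
    absorbed into the factor 6. *)
Lemma lg_ratio_le n k :
  (1 <= k)%nat -> (32 * k <= n)%nat ->
  lg (INR n / INR k) <= 6 * INR (S (Nat.log2 (n / (32 * k)))).
Proof.
  intros Hk Hn. set (q := (n / (32 * k))%nat).
  assert (Hq : (1 <= q)%nat) by (apply Nat.div_le_lower_bound; lia).
  pose proof (Nat.log2_spec q ltac:(lia)) as [_ Hlog].
  set (j := S (Nat.log2 q)) in *.
  assert (Hnk : (n <= 2 ^ (j + 5) * k)%nat).
  { pose proof (Nat.mul_succ_div_gt n (32 * k) ltac:(lia)) as Hd. fold q in Hd.
    rewrite Nat.pow_add_r. simpl (2 ^ 5)%nat. nia. }
  assert (Hk0 : 0 < INR k) by (apply lt_0_INR; lia).
  assert (Hle : lg (INR n / INR k) <= INR (j + 5)).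
  { apply lg_le_of_le_pow; [|lia].
    apply le_INR in Hnk. rewrite mult_INR, pow_INR in Hnk. simpl (INR 2) in Hnk.
    apply Rmult_le_reg_r with (INR k); [exact Hk0|].
    replace (INR n / INR k * INR k) with (INR n) by (field; lra). exact Hnk. }
  rewrite plus_INR in Hle. simpl (INR 5) in Hle.
  assert (1 <= INR j) by (change 1 with (INR 1); apply le_INR; unfold j; lia).
  lra.
Qed.

Lemma Fk_all_words n k R :
  (1 <= n)%nat -> (1 <= k)%nat ->
  Fk_ge k n (concat (all_words_repeated n (2 * k) R))
    (/ 24 * INR (length (concat (all_words_repeated n (2 * k) R))) * lg (INR n / INR k)).
Proof.
  intros Hn Hk T l f HT [_ [Hlen Hf]].
  destruct (Nat.le_gt_cases (32 * k) n) as [Hkn|Hkn].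
  - pose proof (lg_ratio_le n k Hk Hkn) as Hlg.
    assert (Hpow : (2 ^ Nat.log2 (n / (32 * k)) * (32 * k) <= n)%nat).
    { assert (1 <= n / (32 * k))%nat by (apply Nat.div_le_lower_bound; lia).
      pose proof (Nat.log2_spec (n / (32 * k)) ltac:(lia)) as [Hlog _].
      pose proof (Nat.Div0.mul_div_le n (32 * k)). nia. }
    (* The factor 4 here and the factor 6 from [lg_ratio_le] give the constant [/ 24]. *)
    pose proof (finger_cost_all_words n k R _ T l f Hn HT Hpow Hlen Hf) as H.
    set (m := length (concat (all_words_repeated n (2 * k) R))) in *.
    apply le_INR in H. rewrite !mult_INR in H. simpl (INR 4) in H.
    pose proof (pos_INR m).
    assert (INR m * lg (INR n / INR k)
            <= INR m * (6 * INR (S (Nat.log2 (n / (32 * k))))))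
      by (apply Rmult_le_compat_l; assumption).
    lra.
  (* For [n < 32k], [lg (n / k)] is at most 5, so the unit cost of each access suffices. *)
  - pose proof (finger_cost_ge_length T l _ f Hlen) as H.
    set (m := length (concat (all_words_repeated n (2 * k) R))) in *.
    apply le_INR in H.
    assert (Hk0 : 0 < INR k) by (apply lt_0_INR; lia).
    assert (Hlg : lg (INR n / INR k) <= INR 5).
    { apply lg_le_of_le_pow; [|lia].
      apply Rmult_le_reg_r with (INR k); [exact Hk0|].
      replace (INR n / INR k * INR k) with (INR n) by (field; lra).
      apply Nat.lt_le_incl, le_INR in Hkn. rewrite mult_INR in Hkn.
      replace (INR 32) with (2 ^ 5) in Hkn by (simpl; lra). exact Hkn. }
    simpl (INR 5) in Hlg. pose proof (pos_INR m).
    assert (INR m * lg (INR n / INR k) <= INR m * 5)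
      by (apply Rmult_le_compat_l; lra).
    lra.
Qed.

Theorem theorem32 (eps C0 : R) :
  0 < eps -> 0 < C0 ->
  exists c1 c2 : R, 0 < c1 /\ 0 < c2 /\
  exists N : nat, forall n k : nat,
    (N <= n)%nat -> (1 <= k)%nat ->
    INR k <= C0 * Rpower (INR n) (1/2 - eps) ->
    exists S : list nat,
      (0 < length S)%nat /\
      Forall (fun x => (1 <= x <= n)%nat) S /\
      WS S <= c1 * INR (length S) * lg (INR k) /\
      Fk_ge k n S (c2 * INR (length S) * lg (INR n / INR k)).
Proof.
  intros _ _. exists 3, (/ 24). split; [lra|]. split; [lra|].
  exists 1%nat. intros n k Hn Hk _.
  (* With [n] repetitions the amortisation condition becomes [lg n <= n]. *)
  exists (concat (all_words_repeated n (2 * k) n)).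
  split; [|split; [|split]].
  - rewrite length_concat_all_words_repeated.
    assert (n ^ (2 * k) <> 0)%nat by (apply Nat.pow_nonzero; lia). nia.
  - apply Forall_concat, Forall_forall. intros A HA.
    apply all_words_repeated_In in HA as [_ HA]. now apply Forall_forall.
  - apply WS_all_words; [exact Hn|]. now apply lg_INR_le.
  - now apply Fk_all_words.
Qed.
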